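(* Let $X$ be a rack, and let $n,m$ be positive integers. Fix $e_1,\ldots,e_m\in\mathbb Z$ and $i_1,\ldots,i_m\in\{1,\ldots,n\}$. Then $X^n$ is a rack with the binary operation defined by \[(x_1,\ldots,x_n)*(y_1,\ldots,y_n)=(x_1*^{e_1}y_{i_1}*^{e_2}\cdots*^{e_m}y_{i_m},\ \ldots,\ x_n*^{e_1}y_{i_1}*^{e_2}\cdots*^{e_m}y_{i_m}).\]
   Context: A rack is a non-empty set $X$ with a binary operation $*:X\times X\to X$ such that for every $a\in X$ the map $S_a:X\to X$, $S_a(x)=x*a$, is a bijection, and $(x*y)*z=(x*z)*(y*z)$ for all $x,y,z\in X$. For $a,x\in X$ and $k\in\mathbb Z$ write $x*^ka:=S_a^k(x)$ (with $S_a^0=\mathrm{id}_X$). Expressions without parentheses are read from left to right: $x*^{k_1}x_1*^{k_2}x_2\cdots*^{k_m}x_m:=S_{x_m}^{k_m}\circ\cdots\circ S_{x_2}^{k_2}\circ S_{x_1}^{k_1}(x)$. Thus the $j$-th entry of the product above is $S_{y_{i_m}}^{e_m}\circ\cdots\circ S_{y_{i_1}}^{e_1}(x_j)$. *)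

(* Defs.v *)
From mathcomp Require Import all_boot all_algebra.
From mathcomp Require Import boolp.

Set Implicit Arguments.
Unset Strict Implicit.
Unset Printing Implicit Defensive.

Record is_rack (X : Type) (op : X -> X -> X) : Prop := IsRack {
  rack_nonempty : inhabited X;
  rack_bijective : forall a, bijective (fun x => op x a);
  rack_distrib : forall x y z, op (op x y) z = op (op x z) (op y z)
}.

Structure rack : Type := Rack {
  rack_sort :> Type;
  rack_op : rack_sort -> rack_sort -> rack_sort;
  rackP : is_rack rack_op
}.

Definition rack_S (X : rack) (a : X) : X -> X := fun x => rack_op x a.

Lemma rack_S_surj (X : rack) (a y : X) : exists x, rack_S a x = y.
Proof. by have [g _ gK] := rack_bijective (rackP X) a; exists (g y); apply: gK. Qed.

(* Bijectivity is a mere proposition, so the preimage under S_a is extracted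
   with the choice principle [cid]; it is unique since S_a is injective. *)
Definition rack_Sinv (X : rack) (a : X) : X -> X :=
  fun y => projT1 (cid (rack_S_surj a y)).

Lemma rack_SinvK (X : rack) (a : X) : cancel (rack_Sinv a) (rack_S a).
Proof. by move=> y; rewrite /rack_Sinv; case: cid. Qed.

Lemma rack_SK (X : rack) (a : X) : cancel (rack_S a) (rack_Sinv a).
Proof.
by move=> x; apply: (bij_inj (rack_bijective (rackP X) a)); apply: rack_SinvK.
Qed.

(* x *^k a = S_a^k(x); recall that [Negz p] is the integer -(p+1). *)
Definition rack_exp (X : rack) (x : X) (k : int) (a : X) : X :=
  match k with
  | Posz p => iter p (rack_S a) x
  | Negz p => iter p.+1 (rack_Sinv a) x
  end.

(* x *^(e 0) a 0 *^(e 1) a 1 ... *^(e (m-1)) a (m-1), read from left to right: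
   [enum 'I_m] lists the indices in increasing order. *)
Definition rack_word (X : rack) (m : nat) (e : 'I_m -> int) (a : 'I_m -> X)
    (x : X) : X :=
  foldl (fun z k => rack_exp z (e k) (a k)) x (enum 'I_m).

Definition rack_tuple_op (X : rack) (n m : nat) (e : 'I_m -> int)
    (i : 'I_m -> 'I_n) (x y : n.-tuple X) : n.-tuple X :=
  [tuple rack_word e (fun k => tnth y (i k)) (tnth x j) | j < n].

(* Main.v *)
(** Every [S_a] is a rack endomorphism by self-distributivity, hence so is every
    word [w_b] in the maps [S_(b k)] and their inverses; and an endomorphism [f]
    carries such a word to the word with letters [f (b k)]. For the columns of
    the tuple operation, [f := w_z] applied to [w_y x] is exactly the required
    self-distributivity. *)
Require Import Defs.
From mathcomp Require Import all_boot all_algebra.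

Set Implicit Arguments.
Unset Strict Implicit.
Unset Printing Implicit Defensive.

Definition rack_endo (X : rack) (f : X -> X) : Prop :=
  forall x a, f (rack_S a x) = rack_S (f a) (f x).

Lemma rack_S_endo (X : rack) (a : X) : rack_endo (rack_S a).
Proof. by move=> x b; rewrite /rack_S (rack_distrib (rackP X)). Qed.

Lemma rack_endo_Sinv (X : rack) (f : X -> X) :
  rack_endo f -> forall x a, f (rack_Sinv a x) = rack_Sinv (f a) (f x).
Proof.
by move=> f_endo x a; rewrite -{2}(rack_SinvK a x) f_endo rack_SK.
Qed.

(** The inverse of a bijective endomorphism is one: both sides agree after applying the injective
    [rack_S a]. *)
Lemma rack_Sinv_endo (X : rack) (a : X) : rack_endo (rack_Sinv a).
Proof.
move=> x b; apply: (can_inj (@rack_SK X a)).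
by rewrite rack_S_endo !rack_SinvK.
Qed.

Lemma rack_endo_exp (X : rack) (f : X -> X) : rack_endo f ->
  forall x k a, f (rack_exp x k a) = rack_exp (f x) k (f a).
Proof.
move=> f_endo x [] p a; rewrite /rack_exp.
  by elim: p => //= p <-; rewrite f_endo.
(* [Negz p] iterates [p.+1] times; generalizing that count lets the induction start at 0. *)
by elim: p.+1 => //= q <-; rewrite rack_endo_Sinv.
Qed.

Lemma rack_exp_endo (X : rack) (k : int) (a : X) :
  rack_endo (fun x => rack_exp x k a).
Proof.
move=> x b; rewrite /rack_exp; case: k => p.
  by elim: p => //= p ->; rewrite rack_S_endo.
by elim: p.+1 => //= q ->; rewrite rack_Sinv_endo.
Qed.

Lemma bij_iter (T : Type) (f : T -> T) (n : nat) :
  bijective f -> bijective (iter n f).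
Proof.
by move=> f_bij; elim: n => [|n IHn]; [exists id | apply: bij_comp].
Qed.

Lemma rack_exp_bij (X : rack) (k : int) (a : X) :
  bijective (fun x => rack_exp x k a).
Proof.
have SK := @rack_SK X a; have SinvK := @rack_SinvK X a.
by case: k => p; apply: bij_iter;
  [exists (rack_Sinv a) | exists (rack_S a)].
Qed.

Lemma rack_endo_word (X : rack) (m : nat) (e : 'I_m -> int) (f : X -> X) :
  rack_endo f ->
  forall b x, f (rack_word e b x) = rack_word e (f \o b) (f x).
Proof.
move=> f_endo b x; rewrite /rack_word.
by elim: (enum 'I_m) x => //= k s IHs x; rewrite IHs rack_endo_exp.
Qed.

Lemma rack_word_endo (X : rack) (m : nat) (e : 'I_m -> int) (b : 'I_m -> X) :
  rack_endo (rack_word e b).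
Proof.
move=> x a; rewrite /rack_word.
(* Both [x] and [a] must vary: the first letter moves each of them before the rest of the word
   acts. *)
by elim: (enum 'I_m) x a => //= k s IHs x a; rewrite rack_exp_endo IHs.
Qed.

Lemma rack_word_bij (X : rack) (m : nat) (e : 'I_m -> int) (b : 'I_m -> X) :
  bijective (rack_word e b).
Proof.
rewrite /rack_word; elim: (enum 'I_m) => [|k s IHs] /=; first by exists id.
exact: bij_comp IHs (rack_exp_bij _ _).
Qed.

Lemma rack_word_ext (X : rack) (m : nat) (e : 'I_m -> int) (b c : 'I_m -> X) :
  b =1 c -> rack_word e b =1 rack_word e c.
Proof.
move=> eq_bc x; rewrite /rack_word.
by elim: (enum 'I_m) x => //= k s IHs x; rewrite IHs eq_bc.
Qed.

Theorem proposition3p1 (X : rack) (n m : nat) (hn : 0 < n) (hm : 0 < m)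
    (e : 'I_m -> int) (i : 'I_m -> 'I_n) :
  is_rack (@rack_tuple_op X n m e i).
Proof.
split=> [|a|x y z].
- by have [x] := rack_nonempty (rackP X); exact: (inhabits [tuple of nseq n x]).
(* The word depends only on [a], so one inverse [g] serves every column. *)
- have [g wK gK] := rack_word_bij e (fun k => tnth a (i k)).
  exists (map_tuple g) => x; apply: eq_from_tnth => j.
    by rewrite tnth_map tnth_mktuple wK.
  by rewrite tnth_mktuple tnth_map gK.
apply: eq_from_tnth => j; rewrite !tnth_mktuple.
rewrite (rack_endo_word _ (rack_word_endo _ _)).
(* Entry [i k] of the product of [y] and [z] is [w_z] applied to [tnth y (i k)], so the letters
   agree pointwise. *)
by apply: rack_word_ext => k /=; rewrite tnth_mktuple.
Qed.
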